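(* Let $T$ be a tree. On the Lipschitz space $\mathcal{L}(T)$ the spectrum of the differentiation operator $D$ is the closed disk $\overline{D(1,1)}=\{\lambda\in\mathbb{C}:|\lambda-1|\leq 1\}$.
   Context: A tree $T$ is a locally finite, connected, simply-connected graph, identified with its set of vertices. A vertex is terminal if it has a unique neighbor; all trees are assumed to be without terminal vertices (hence infinite) and rooted at a vertex $o$; $T^*=T\setminus\{o\}$. For $v\neq o$, $v^-$ denotes the unique neighbor of $v$ lying on the path from $o$ to $v$ (the parent of $v$). The derivative of $f:T\to\mathbb{C}$ is $f'(v)=f(v)-f(v^-)$ for $v\neq o$ and $f'(o)=0$; the differentiation operator is $Df=f'$. The Lipschitz space $\mathcal{L}(T)$ is the set of all $f:T\to\mathbb{C}$ with $\sup_{v\in T^*}|f'(v)|<\infty$; it is a Banach space under the norm $\|f\|_{\mathcal{L}}=|f(o)|+\sup_{v\in T^*}|f'(v)|$. $D$ is a bounded operator from $\mathcal{L}(T)$ to $\mathcal{L}(T)$. *)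

(* Defs.v *)
From HB Require Import structures.
From mathcomp Require Import all_boot all_order all_algebra complex.
From mathcomp Require Import boolp classical_sets functions cardinality reals.
From mathcomp Require Import topology normedtype.

Set Implicit Arguments.
Unset Strict Implicit.
Unset Printing Implicit Defensive.

Import Order.TTheory GRing.Theory Num.Theory.
Import numFieldNormedType.Exports.
Import Normc.

Local Open Scope classical_set_scope.
Local Open Scope ring_scope.
Local Open Scope complex_scope.

(* [tree_acyclic]: no closed walk through at least three vertices, all of
   them distinct. [tree_infinite] only excludes the one-vertex graph, whose
   unique vertex has no neighbor and hence is not terminal. *)
Record rootedTree := RootedTree {
  vertex :> choiceType;
  adj : rel vertex;
  root : vertex;
  adj_sym : symmetric adj;
  adj_irr : irreflexive adj;
  tree_locally_finite : forall v, finite_set [set w | adj v w];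
  tree_connected : forall v w, exists p, path adj v p /\ last v p = w;
  tree_acyclic : forall c, (2 < size c)%N -> ~~ ucycleb adj c;
  tree_no_terminal : forall v, ~ exists! w, adj v w;
  tree_infinite : infinite_set [set: vertex]
}.

Section Parent.
Variable T : rootedTree.
Implicit Types v w : T.
Local Notation o := (root T).

Definition is_parent v w := adj w v /\
  exists p, [/\ path (@adj T) o p, uniq (o :: p), last o p = v & w \in o :: p].

(* Meaningful for [v != root T], where [is_parent v] has exactly one element
   (see [parent_rcons]). *)
Definition parent v : T := xget o [set w | is_parent v w].

Lemma simple_path_uniq x (p q : seq T) :
  path (@adj T) x p -> uniq (x :: p) -> path (@adj T) x q -> uniq (x :: q) ->
  last x p = last x q -> p = q.
Proof.
elim: p x q => [|a p IHp] x [|b q] //=.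
- by move=> _ _ _ /andP[xq _] xE; move: xq; rewrite xE mem_last.
- by move=> _ /andP[xq _] _ _ xE; move: xq; rewrite -xE mem_last.
move=> /andP[xa pa] /andP[xNp up] /andP[xb qb] /andP[xNq uq] lastE.
have [ab|aNb] := eqVneq a b.
  by subst b; congr cons; apply: (IHp a).
exfalso; set r := p ++ rev (belast b q).
have pr : path (@adj T) a r.
  rewrite cat_path pa lastE rev_path.
  by rewrite (@eq_path _ _ (@adj T)) // => u w; rewrite adj_sym.
have lr : last a r = b.
  rewrite /r last_cat lastE; case: (q) => [|c s] //=.
  by rewrite rev_cons last_rcons.
have rsub u : u \in a :: r -> u \in (a :: p) ++ (b :: q).
  rewrite /r -cat_cons !mem_cat mem_rev => /orP[->//|ub].
  by rewrite (mem_belast ub) orbT.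
case/shortenP: pr lr => s ps us sr ls.
have sN : x \notin a :: s.
  apply/negP => xs; have : x \in a :: r.
    by move: xs; rewrite !inE => /orP[->//|/sr ->]; rewrite orbT.
  by move/rsub; rewrite mem_cat (negbTE xNp) (negbTE xNq).
have s0 : s != [::] by apply: contra_neq aNb => s0; rewrite -ls s0.
have := @tree_acyclic T (x :: a :: s).
rewrite /ucycleb /cycle /= xa rcons_path ps ls adj_sym xb /=.
by move: us sN => /= -> ->; case: (s) s0 => // ? ? _ /(_ isT).
Qed.

Lemma parent_rcons p v : path (@adj T) o (rcons p v) ->
  uniq (o :: rcons p v) -> parent v = last o p.
Proof.
move=> pv uv; apply: xget_unique => /=.
  split; first by move: pv; rewrite rcons_path => /andP[].
  by exists (rcons p v); split; rewrite ?last_rcons// -rcons_cons mem_rcons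
    inE mem_last orbT.
move=> w [wv [q [pq uq lq wq]]].
have qE : q = rcons p v.
  by apply: (@simple_path_uniq o) => //; rewrite last_rcons.
have wNv : w != v by apply: contraTneq wv => ->; rewrite adj_irr.
move: wq; rewrite qE -rcons_cons mem_rcons inE (negbTE wNv) /= => wp.
move: pv uv; case/splitPl: wp => p1 p2 lp1 pv uv.
suff p1E : p1 = p1 ++ p2 by rewrite -p1E.
apply: (@rcons_injl _ v); apply: (@simple_path_uniq o) => //.
- by rewrite rcons_path lp1 wv andbT; move: pv;
    rewrite rcons_cat cat_path => /andP[].
- apply: subseq_uniq uv; rewrite rcons_cat -!cats1 /= eqxx.
  by rewrite cat_subseq// suffix_subseq.
- by rewrite !last_rcons.
Qed.

Lemma simple_path_ex v :
  exists p, [/\ path (@adj T) o p, uniq (o :: p) & last o p = v].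
Proof.
have [p [pp <-]] := tree_connected o v.
by case/shortenP: pp => q pq uq _; exists q.
Qed.

Lemma tree_nonroot : exists v : T, v != o.
Proof.
apply: contrapT => /forallNP h; apply: (@tree_infinite T).
apply: (sub_finite_set _ (finite_set1 o)) => v _ /=.
by apply/eqP/negPn/negP; exact: h.
Qed.

End Parent.

Section Lipschitz.
Variables (R : realType) (T : rootedTree).
Local Notation C := (R[i]).
Local Notation o := (root T).
Implicit Types f g : T -> C.

Definition tree_deriv f : T -> C :=
  fun v => if v == o then 0 else f v - f (parent v).

Definition deriv_moduli f : set R :=
  [set normc (tree_deriv f v) | v in [set v | v != o]].

Definition lipschitz_fun : {pred (T -> C)} :=
  [pred f | `[< has_ubound (deriv_moduli f) >]].

Lemma lipschitz_funP f : reflect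
  (exists M, forall v, v != o -> normc (tree_deriv f v) <= M)
  (f \in lipschitz_fun).
Proof.
apply: (iffP (asboolP _)) => -[M fM]; exists M.
  by move=> v vo; apply: fM; exists v.
by move=> _ [v vo <-]; exact: fM.
Qed.

Lemma tree_derivP a f g v :
  tree_deriv (a *: f + g) v = a * tree_deriv f v + tree_deriv g v.
Proof.
rewrite /tree_deriv; case: ifP => _; first by rewrite mulr0 addr0.
by rewrite !fctE mulrBr opprD addrACA.
Qed.

Lemma lipschitz_fun_submod_closed : submod_closed lipschitz_fun.
Proof.
split=> [|a f g /lipschitz_funP[M fM] /lipschitz_funP[N gN]].
  apply/lipschitz_funP; exists 0 => v vo.
  by rewrite /tree_deriv (negbTE vo) subrr normc0.
apply/lipschitz_funP; exists (normc a * M + N) => v vo.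
rewrite tree_derivP (le_trans (le_normcD _ _))// normcM.
by rewrite lerD ?gN// ler_wpM2l ?fM//; case: (a) => ? ?; exact: sqrtr_ge0.
Qed.

HB.instance Definition _ := GRing.isSubmodClosed.Build _ _ lipschitz_fun
  lipschitz_fun_submod_closed.

Record lipschitz_space := Lipschitz {
  lipschitz_val :> T -> C;
  lipschitz_valP : lipschitz_val \in lipschitz_fun }.

HB.instance Definition _ := [isSub for lipschitz_val].
HB.instance Definition _ := [Choice of lipschitz_space by <:].
HB.instance Definition _ := [SubChoice_isSubLmodule of lipschitz_space by <:].

End Lipschitz.

Section LipschitzNorm.
Variables (R : realType) (T : rootedTree).
Local Notation C := (R[i]).
Local Notation o := (root T).
Local Notation L := (lipschitz_space R T).
Implicit Types f g : L.

Definition lipschitz_norm f : R := normc (f o) + sup (deriv_moduli f).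

Lemma normc_ge0 (z : C) : 0 <= normc z.
Proof. by case: z => ? ?; exact: sqrtr_ge0. Qed.

Lemma normcCE (z : C) : `|z| = (normc z)%:C.
Proof. by case: z. Qed.

Lemma tree_deriv_le_sup f v : v != o ->
  normc (tree_deriv f v) <= sup (deriv_moduli f).
Proof.
move=> vo; apply: ub_le_sup; last by exists v.
by have := lipschitz_valP f => /asboolP.
Qed.

Lemma sup_deriv_le f M : (forall v, v != o -> normc (tree_deriv f v) <= M) ->
  sup (deriv_moduli f) <= M.
Proof.
move=> fM; apply: ge_sup; last by move=> _ [v vo <-]; exact: fM.
by have [v vo] := tree_nonroot T; exists (normc (tree_deriv f v)), v.
Qed.

Lemma sup_deriv_ge0 f : 0 <= sup (deriv_moduli f).
Proof.
have [v vo] := tree_nonroot T.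
exact: le_trans (normc_ge0 _) (tree_deriv_le_sup f vo).
Qed.

Lemma lipschitz_normD f g :
  (lipschitz_norm (f + g))%:C <= (lipschitz_norm f)%:C + (lipschitz_norm g)%:C.
Proof.
rewrite -rmorphD lecR /lipschitz_norm addrACA lerD//.
  exact: le_normcD.
apply: sup_deriv_le => v vo.
have -> : tree_deriv (f + g) v = tree_deriv f v + tree_deriv g v.
  by have := tree_derivP 1 f g v; rewrite scale1r mul1r.
by rewrite (le_trans (le_normcD _ _))// lerD ?tree_deriv_le_sup.
Qed.

Lemma lipschitz_normZ (a : C) f :
  (lipschitz_norm (a *: f))%:C = `|a| * (lipschitz_norm f)%:C.
Proof.
have le_normZ (b : C) (g : L) :
    lipschitz_norm (b *: g) <= normc b * lipschitz_norm g.
  rewrite /lipschitz_norm mulrDr lerD//.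
    by rewrite -normcM.
  apply: sup_deriv_le => v vo.
  have -> : tree_deriv (b *: g) v = b * tree_deriv g v.
    have := tree_derivP b g 0 v; rewrite addr0 => ->.
    by rewrite /tree_deriv (negbTE vo) subrr addr0.
  by rewrite normcM ler_wpM2l ?normc_ge0// tree_deriv_le_sup.
rewrite normcCE -rmorphM; congr (_%:C); apply/eqP; rewrite eq_le le_normZ /=.
have [->|a0] := eqVneq a 0.
  by rewrite normc0 mul0r addr_ge0 ?normc_ge0 ?sup_deriv_ge0.
have na0 : 0 < normc a.
  by rewrite lt_neqAle normc_ge0 andbT eq_sym; apply: contra_neq a0 => /eq0_normc.
rewrite -ler_pdivlMl// -normcV.
by have := le_normZ a^-1 (a *: f); rewrite scalerA mulVf// scale1r.
Qed.

Lemma lipschitz_norm0_eq0 f : (lipschitz_norm f)%:C = 0 -> f = 0.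
Proof.
case=> /eqP; rewrite paddr_eq0 ?normc_ge0 ?sup_deriv_ge0//.
move=> /andP[/eqP/eq0_normc fo /eqP f'0].
apply/val_inj/funext => v /=.
have [p [+ + <-]] := simple_path_ex v.
elim/last_ind: p {v} => [//|p v IHp] pv uv.
have vo : v != o.
  apply: contraTneq uv => ->.
  by rewrite cons_uniq mem_rcons mem_head.
have := tree_deriv_le_sup f vo; rewrite f'0 /tree_deriv (negbTE vo).
rewrite (parent_rcons pv uv) last_rcons IHp.
- rewrite subr0 => fv0; apply: eq0_normc.
  by apply/eqP; rewrite eq_le fv0 normc_ge0.
- by move: pv; rewrite rcons_path => /andP[].
- by move: uv; rewrite -rcons_cons rcons_uniq => /andP[].
Qed.

HB.instance Definition _ := @Lmodule_isNormed.Build C L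
  (fun f => (lipschitz_norm f)%:C) lipschitz_normD lipschitz_normZ
  lipschitz_norm0_eq0.

Lemma lipschitz_normE f : `|f| = (normc (f o) + sup (deriv_moduli f))%:C.
Proof. by []. Qed.

Lemma tree_deriv2_le f v : v != o ->
  normc (tree_deriv (tree_deriv f) v) <= sup (deriv_moduli f) *+ 2.
Proof.
have le1 w : normc (tree_deriv f w) <= sup (deriv_moduli f).
  have [->|wo] := eqVneq w o; last exact: tree_deriv_le_sup.
  by rewrite /tree_deriv eqxx normc0 sup_deriv_ge0.
move=> vo; rewrite {1}/tree_deriv (negbTE vo) mulr2n.
by rewrite (le_trans (le_normcD _ _))// normcN lerD.
Qed.

Lemma tree_deriv_lipschitz f : tree_deriv f \in @lipschitz_fun R T.
Proof.
apply/lipschitz_funP; exists (sup (deriv_moduli f) *+ 2) => v.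
exact: tree_deriv2_le.
Qed.

Definition diff_op f : L := Lipschitz (tree_deriv_lipschitz f).

Lemma diff_op_linear : linear diff_op.
Proof. by move=> a f g; apply/val_inj/funext => v; exact: tree_derivP. Qed.

HB.instance Definition _ :=
  GRing.isLinear.Build C L L *:%R diff_op diff_op_linear.

Lemma diff_op_bounded : bounded_near diff_op (nbhs (0 : L)).
Proof.
apply/bounded_funP => r; exists (r *+ 2) => f fr.
apply: le_trans (_ : `|f| *+ 2 <= _); last by rewrite lerMn2r.
rewrite !lipschitz_normE -rmorphMn lecR.
rewrite [X in normc X](_ : _ = 0) ?normc0 ?add0r ?mulrnDl; last first.
  by rewrite /= /tree_deriv eqxx.
rewrite (le_trans (@sup_deriv_le (diff_op f) _ (@tree_deriv2_le f)))//.
by rewrite lerDr mulrn_wge0 ?normc_ge0.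
Qed.

End LipschitzNorm.

(* The resolvent set consists of the [lambda] such that [A - lambda I] has a
   two-sided inverse among the bounded linear operators on [V]. *)
Definition spectrum (K : numFieldType) (V : normedModType K)
    (A : {linear V -> V}) : set K :=
  [set lambda | ~ exists B : {linear V -> V},
    [/\ bounded_near B (nbhs (0 : V)),
        cancel (fun x => A x - lambda *: x) B &
        cancel B (fun x => A x - lambda *: x)]].

(* Main.v *)
Require Import Defs.
From HB Require Import structures.
From mathcomp Require Import all_boot all_order all_algebra complex.
From mathcomp Require Import boolp classical_sets functions cardinality reals.
From mathcomp Require Import topology normedtype.
From mathcomp Require Import ring.
Import Order.TTheory GRing.Theory Num.Theory.
Import numFieldNormedType.Exports.
Local Open Scope classical_set_scope.
Local Open Scope ring_scope.
Local Open Scope complex_scope.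

(** Write [mu = 1 - lambda], so that the closed disk is [`|mu| <= 1].  Away
    from the root the equation [D f - lambda f = g] reads
    [mu f(v) = g(v) + f(parent v)], and at the root [- lambda f(o) = g(o)].
    Since [D] commutes with [D - lambda], the derivatives satisfy
      [mu f'(v) = g'(v) + f'(parent v)],  with [f'(o) = 0],        (R)
    a first-order recursion along the branches of the tree.

    If [`|mu| > 1] then [lambda] and [mu] are both nonzero and the equation has
    exactly one solution, computed from the root outwards ([resolvent_fun]).
    The recursion (R) is contracting: it keeps [`|f'|] below
    [sup `|g'| / (`|mu| - 1)] ([resolvent_deriv_le]), so the solution operator
    is bounded on the Lipschitz space.

    If [`|mu| <= 1] then [D - lambda] is not onto.  Pick [u] with [`|u| = 1] and
    [u * mu = `|mu|], and let [g] be the Lipschitz function with [g(o) = 0] and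
    [g'(v) = u ^ (n - 1)] at depth [n].  The phases are tuned so that all the
    terms of the solution of (R) align: at depth [n],
      [mu ^ n f'(v) = \sum_(k < n) `|mu| ^ k >= n `|mu| ^ n].
    For [mu = 0] this is absurd at depth 1; otherwise [`|f'(v)| >= n], and since
    the tree has no terminal vertex it has vertices of every depth, so that [f]
    is not Lipschitz.  This covers the eigenvalue [lambda = 0] too. *)

(** * Depth in a rooted tree *)

Section Depth.
Context {T : rootedTree}.
Local Notation o := (Defs.root T).
Implicit Types v : T.

Definition depth v : nat := size (sval (cid (simple_path_ex v))).

Lemma depth_last (p : seq T) :
  path (@adj T) o p -> uniq (o :: p) -> depth (last o p) = size p.
Proof.
move=> pp up; rewrite /depth; case: cid => q [pq uq lq] /=.
by rewrite (@simple_path_uniq T o q p).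
Qed.

Lemma depth_root : depth o = 0%N.
Proof. by rewrite -[o]/(last o [::]) depth_last. Qed.

Lemma nonroot_simple_path v : v != o ->
  exists p, path (@adj T) o (rcons p v) /\ uniq (o :: rcons p v).
Proof.
have [p [+ + <-]] := simple_path_ex v.
case/lastP: p => [|p w]; first by rewrite eqxx.
by rewrite last_rcons => pp up _; exists p.
Qed.

Lemma depth_parent v : v != o -> depth v = (depth (parent v)).+1.
Proof.
move=> /nonroot_simple_path[p [pp up]].
rewrite (parent_rcons pp up) -{1}(last_rcons o p v) !depth_last//.
- by rewrite size_rcons.
- by move: pp; rewrite rcons_path => /andP[].
- by move: up; rewrite -rcons_cons rcons_uniq => /andP[].
Qed.

Lemma depth_gt0 v : (0 < depth v)%N -> v != o.
Proof. by apply: contraTneq => ->; rewrite depth_root. Qed.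

Lemma tree_ind (P : T -> Prop) :
  P o -> (forall v, v != o -> P (parent v) -> P v) -> forall v, P v.
Proof.
move=> Po PS v; have [n vn] := ubnP (depth v).
elim: n v vn => // n IHn v; have [->//|vo] := eqVneq v o.
by rewrite depth_parent// ltnS => vn; apply: PS => //; apply: IHn.
Qed.

(** A non-root vertex has a neighbor besides its parent, as it is not terminal,
    and that neighbor lies off the path from the root: a neighbor of [v] on the
    path would be a second candidate for the parent of [v]. *)
Lemma simple_path_extend (p : seq T) v :
  path (@adj T) o (rcons p v) -> uniq (o :: rcons p v) ->
  exists w, adj v w /\ w \notin o :: rcons p v.
Proof.
move=> pp up; apply: contrapT => /forallNP noext.
have adjp : adj (last o p) v by move: pp; rewrite rcons_path => /andP[].
apply: (@tree_no_terminal T v); exists (last o p); split; first by rewrite adj_sym.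
move=> w vw; have : w \in o :: rcons p v.
  by apply/negPn/negP => wNp; apply: (noext w).
rewrite -rcons_cons mem_rcons inE => /orP[/eqP wv|wp].
  by move: vw; rewrite wv adj_irr.
move: wp pp up; case/splitPl => p1 p2 lp1 pp up.
have p1v : path (@adj T) o (rcons p1 v).
  rewrite rcons_path lp1 adj_sym vw andbT.
  by move: pp; rewrite rcons_cat cat_path => /andP[].
have u1v : uniq (o :: rcons p1 v).
  apply: subseq_uniq up; rewrite rcons_cat -!cats1 /= eqxx.
  by rewrite cat_subseq// suffix_subseq.
by rewrite -(parent_rcons pp up) (parent_rcons p1v u1v) lp1.
Qed.

Lemma depth_surj n : exists v, depth v = n.
Proof.
suff [p [pp up <-]] : exists p, [/\ path (@adj T) o p, uniq (o :: p) & size p = n].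
  by exists (last o p); exact: depth_last.
elim: n => [|n [p [pp up <-]]]; first by exists [::].
case/lastP: p pp up => [|p v] pp up.
  (* The root has no parent, so the extension argument does not apply to it:
     take the first step towards any other vertex. *)
  have [w /nonroot_simple_path[q []]] := tree_nonroot T.
  case: (rcons q w) (size_rcons q w) => // a s _ /= /andP[oa _] /andP[].
  rewrite inE negb_or => /andP[oNa _] _.
  by exists [:: a]; rewrite /= oa inE oNa.
have [w [vw wNp]] := simple_path_extend p v pp up.
exists (rcons (rcons p v) w); split; last by rewrite !size_rcons.
  by rewrite rcons_path pp last_rcons.
by rewrite -rcons_cons rcons_uniq wNp.
Qed.

End Depth.

(** * The recursion satisfied by the derivative *)

Section Recursion.
Context {R : realType} {T : rootedTree}.
Local Notation C := (R[i]).
Local Notation o := (Defs.root T).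
Local Notation L := (lipschitz_space R T).
Implicit Types (f g : T -> C) (v : T) (lambda : C).

(** A complex number above some modulus is a nonnegative real, hence is its own
    modulus: real Lipschitz bounds can be read off complex ones. *)
Lemma norm_le_normc (x M : C) : `|x| <= M -> Normc.normc x <= Normc.normc M.
Proof.
move=> xM; rewrite -lecR -!normcCE.
by rewrite (ger0_norm (le_trans (normr_ge0 x) xM)).
Qed.

Lemma lipschitz_fun_norm_le f (M : C) :
  (forall v, v != o -> `|tree_deriv f v| <= M) -> f \in @lipschitz_fun R T.
Proof.
move=> fM; apply/lipschitz_funP; exists (Normc.normc M) => v vo.
exact: norm_le_normc _ _ (fM v vo).
Qed.

Lemma norm_tree_deriv_le (g : L) v : v != o ->
  `|tree_deriv g v| <= (sup (deriv_moduli g))%:C.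
Proof. by move=> vo; rewrite normcCE lecR tree_deriv_le_sup. Qed.

Lemma sup_deriv_le_norm (g : L) (M : C) :
  (forall v, v != o -> `|tree_deriv g v| <= M) -> (sup (deriv_moduli g))%:C <= M.
Proof.
move=> gM; have [w wo] := tree_nonroot T.
rewrite -(ger0_norm (le_trans (normr_ge0 _) (gM w wo))) normcCE lecR.
by apply: sup_deriv_le => v vo; exact: norm_le_normc _ _ (gM v vo).
Qed.

Lemma sup_derivC_ge0 (g : L) : 0 <= (sup (deriv_moduli g))%:C.
Proof. by rewrite lecR sup_deriv_ge0. Qed.

Lemma tree_deriv_root f : tree_deriv f o = 0.
Proof. by rewrite /tree_deriv eqxx. Qed.

Lemma tree_deriv_nonroot f v : v != o -> tree_deriv f v = f v - f (parent v).
Proof. by rewrite /tree_deriv => /negbTE ->. Qed.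

(** Apply [D] to both sides of [D f - lambda f = g]. *)
Lemma tree_deriv_recursion lambda f g :
  (forall v, tree_deriv f v - lambda * f v = g v) ->
  forall v, v != o ->
  (1 - lambda) * tree_deriv f v = tree_deriv g v + tree_deriv f (parent v).
Proof.
move=> fg v vo; rewrite (tree_deriv_nonroot g)// -!fg.
have -> : f v = tree_deriv f v + f (parent v).
  by rewrite tree_deriv_nonroot// subrK.
ring.
Qed.

End Recursion.

(** * The resolvent outside the closed disk *)

Section Resolvent.
Context {R : realType} {T : rootedTree}.
Local Notation C := (R[i]).
Local Notation o := (Defs.root T).
Local Notation L := (lipschitz_space R T).
Variable lambda : C.
Hypothesis lambda_out : 1 < `|lambda - 1|.
Local Notation mu := (1 - lambda).

Let mu_gt1 : 1 < `|mu|. Proof. by rewrite distrC. Qed.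

Let mu_neq0 : mu != 0.
Proof. by rewrite -normr_gt0 (lt_trans ltr01). Qed.

Let lambda_neq0 : lambda != 0.
Proof. by apply: contraTneq mu_gt1 => ->; rewrite subr0 normr1 ltxx. Qed.

(** The equation solved for [f(v)], unfolded [n] times from [v] towards the
    root: passing to the parent is not a structural recursion, so the depth
    serves as fuel. *)
Fixpoint resolvent_rec (g : T -> C) (n : nat) (v : T) : C :=
  if n is n'.+1 then (g v + resolvent_rec g n' (parent v)) / mu
  else - g o / lambda.

Definition resolvent_fun (g : T -> C) (v : T) : C :=
  resolvent_rec g (depth v) v.

Lemma resolvent_fun_root g : resolvent_fun g o = - g o / lambda.
Proof. by rewrite /resolvent_fun depth_root. Qed.

Lemma resolvent_fun_nonroot g v : v != o ->
  resolvent_fun g v = (g v + resolvent_fun g (parent v)) / mu.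
Proof. by move=> vo; rewrite /resolvent_fun depth_parent. Qed.

Lemma resolvent_funK g v :
  tree_deriv (resolvent_fun g) v - lambda * resolvent_fun g v = g v.
Proof.
have [->|vo] := eqVneq v o.
  by rewrite tree_deriv_root resolvent_fun_root; field.
by rewrite tree_deriv_nonroot// resolvent_fun_nonroot//; field.
Qed.

Lemma resolvent_fun_unique f g :
  (forall v, tree_deriv f v - lambda * f v = g v) -> f = resolvent_fun g.
Proof.
move=> fg; apply/funext; apply: tree_ind => [|v vo IHv].
  by rewrite resolvent_fun_root -fg tree_deriv_root; field.
rewrite resolvent_fun_nonroot// -IHv -fg tree_deriv_nonroot//.
by field.
Qed.

(** [M / (`|mu| - 1)] is the fixed point of [x |-> (M + x) / `|mu|], the bound
    that the recursion carries from a vertex to its children. *)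
Lemma resolvent_deriv_le g (M : C) : 0 <= M ->
  (forall v, v != o -> `|tree_deriv g v| <= M) ->
  forall v, `|tree_deriv (resolvent_fun g) v| <= M / (`|mu| - 1).
Proof.
move=> M0 gM; have mu1 : 0 < `|mu| - 1 by rewrite subr_gt0.
apply: tree_ind => [|v vo IHv].
  by rewrite tree_deriv_root normr0 divr_ge0// ltW.
rewrite -(ler_pM2l (lt_trans ltr01 mu_gt1)) -normrM.
rewrite (tree_deriv_recursion _ _ _ (resolvent_funK g))//.
rewrite (le_trans (ler_normD _ _))// (le_trans (lerD (gM v vo) IHv))//.
rewrite le_eqVlt; apply/orP; left; apply/eqP.
by field; rewrite gt_eqF.
Qed.

Lemma resolvent_fun_lipschitz (g : L) : resolvent_fun g \in @lipschitz_fun R T.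
Proof.
apply: lipschitz_fun_norm_le => v _.
exact: resolvent_deriv_le _ _ (sup_derivC_ge0 g) (norm_tree_deriv_le g) v.
Qed.

Definition resolvent (g : L) : L := Lipschitz (resolvent_fun_lipschitz g).

Lemma resolventK : cancel resolvent (fun f => diff_op f - lambda *: f).
Proof. by move=> g; apply/val_inj/funext => v; exact: resolvent_funK. Qed.

Lemma diff_opBK : cancel (fun f : L => diff_op f - lambda *: f) resolvent.
Proof. by move=> f; apply/val_inj/esym; exact: resolvent_fun_unique. Qed.

(** Linear as the inverse of a linear map. *)
Lemma resolvent_linear : linear resolvent.
Proof.
move=> a f g; rewrite -[RHS]diff_opBK; congr resolvent.
rewrite linearP scalerDr opprD addrACA.
rewrite [lambda *: (a *: _)]scalerA mulrC -scalerA -scalerBr.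
by have /= -> := resolventK f; have /= -> := resolventK g.
Qed.

Lemma resolvent_norm_le g :
  `|resolvent g| <= (`|lambda|^-1 + (`|mu| - 1)^-1) * `|g|.
Proof.
have mu1 : 0 < `|mu| - 1 by rewrite subr_gt0.
rewrite !lipschitz_normE !rmorphD /= -!normcCE resolvent_fun_root.
rewrite mulrDl lerD//.
  rewrite normrM normrN normfV mulrC ler_pM2l ?invr_gt0 ?normr_gt0//.
  by rewrite lerDl sup_derivC_ge0.
apply: (sup_deriv_le_norm (resolvent g)) => v _ /=.
apply: le_trans (resolvent_deriv_le _ _ (sup_derivC_ge0 g)
  (norm_tree_deriv_le g) v) _.
by rewrite mulrC ler_pM2l ?invr_gt0// lerDr.
Qed.

HB.instance Definition _ :=
  GRing.isLinear.Build C L L *:%R resolvent resolvent_linear.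

Lemma resolvent_bounded : bounded_near resolvent (nbhs (0 : L)).
Proof.
apply/bounded_funP => r; exists ((`|lambda|^-1 + (`|mu| - 1)^-1) * r) => g gr.
rewrite (le_trans (resolvent_norm_le g))// ler_wpM2l//.
by rewrite addr_ge0 ?invr_ge0// subr_ge0 ltW.
Qed.

Lemma not_in_spectrum : ~ spectrum (@diff_op R T) lambda.
Proof.
apply; exists resolvent; split; [exact: resolvent_bounded|exact: diff_opBK|].
exact: resolventK.
Qed.

End Resolvent.

(** * Failure of surjectivity on the closed disk *)

Section Spectrum.
Context {R : realType} {T : rootedTree}.
Local Notation C := (R[i]).
Local Notation o := (Defs.root T).
Local Notation L := (lipschitz_space R T).

Definition radial_geometric (u : C) (v : T) : C := \sum_(k < depth v) u ^+ k.

Lemma radial_geometric_deriv u v : v != o ->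
  tree_deriv (radial_geometric u) v = u ^+ depth (parent v).
Proof.
move=> vo; rewrite tree_deriv_nonroot// /radial_geometric depth_parent//.
by rewrite big_ord_recr addrC addKr.
Qed.

Lemma radial_geometric_lipschitz u : `|u| = 1 ->
  radial_geometric u \in @lipschitz_fun R T.
Proof.
move=> u1; apply: (@lipschitz_fun_norm_le _ _ _ 1) => v vo.
by rewrite radial_geometric_deriv// normrX u1 expr1n.
Qed.

Lemma phase_exists (mu : C) : exists u, `|u| = 1 /\ u * mu = `|mu|.
Proof.
have [->|mu0] := eqVneq mu 0; first by exists 1; rewrite mulr0 normr0 normr1.
exists (`|mu| / mu); rewrite divfK// normf_div normr_id divff//.
by rewrite normr_eq0.
Qed.

(** Multiply the recursion at depth [n + 1] by [mu ^ n]: the source term becomes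
    [(u * mu) ^ n], a nonnegative real by the choice of [u], so that the sum
    accumulated along a branch has no cancellation. *)
Lemma radial_solution_deriv (lambda u : C) (f : T -> C) :
  u * (1 - lambda) = `|1 - lambda| ->
  (forall v, tree_deriv f v - lambda * f v = radial_geometric u v) ->
  forall v, (1 - lambda) ^+ depth v * tree_deriv f v =
            \sum_(k < depth v) `|1 - lambda| ^+ k.
Proof.
move=> umu fg; apply: tree_ind => [|v vo IHv].
  by rewrite tree_deriv_root mulr0 depth_root big_ord0.
rewrite depth_parent// big_ord_recr /= -IHv exprSr -mulrA.
rewrite (tree_deriv_recursion _ _ _ fg)// radial_geometric_deriv//.
by rewrite mulrDr -exprMn [_ * u]mulrC umu addrC.
Qed.

Lemma sum_expr_ge (x : C) n : 0 <= x <= 1 -> n%:R * x ^+ n <= \sum_(k < n) x ^+ k.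
Proof.
move=> /andP[x0 x1]; rewrite mulr_natl.
rewrite -[X in _ *+ X]card_ord -sumr_const ler_sum// => k _.
by rewrite ler_wiXn2l// ltnW.
Qed.

(** With [M] a Lipschitz bound for [f], depth 1 rules out [mu = 0] and a depth
    beyond [M] contradicts [n <= `|f'(v)| <= M]. *)
Lemma radial_not_lipschitz (lambda u : C) (f : L) :
  `|1 - lambda| <= 1 -> u * (1 - lambda) = `|1 - lambda| ->
  ~ forall v, tree_deriv f v - lambda * f v = radial_geometric u v.
Proof.
move=> mu1 umu fg; have sumE := radial_solution_deriv _ _ _ umu fg.
have mu0 : 1 - lambda != 0.
  have [v v1] := @depth_surj T 1; have := sumE v.
  rewrite v1 big_ord_recl big_ord0 expr0 expr1 addr0.
  by apply: contra_eqN => /eqP ->; rewrite mul0r eq_sym oner_eq0.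
(* The successor keeps the chosen vertex away from the root. *)
have [n Mn] : exists n, sup (deriv_moduli f) < n.+1%:R.
  exists (Num.bound (sup (deriv_moduli f))).
  apply: lt_trans (archi_boundP (sup_deriv_ge0 f)) _.
  by rewrite ltr_nat.
have [v vn] := @depth_surj T n.+1.
have vo : v != o by rewrite depth_gt0// vn.
have : n.+1%:R <= `|tree_deriv f v|.
  rewrite -(ler_pM2r (_ : 0 < `|1 - lambda| ^+ n.+1)) ?exprn_gt0 ?normr_gt0//.
  apply: (le_trans (sum_expr_ge _ _ _)); first by rewrite normr_ge0.
  rewrite -normrX -normrM [_ * (_ ^+ _)]mulrC -vn sumE ger0_norm//.
  by rewrite sumr_ge0// => k _; rewrite exprn_ge0.
rewrite normcCE -(rmorph_nat (real_complex R)) lecR.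
by move=> /le_trans/(_ (tree_deriv_le_sup f vo)); rewrite leNgt Mn.
Qed.

Lemma in_spectrum (lambda : C) :
  `|lambda - 1| <= 1 -> spectrum (@diff_op R T) lambda.
Proof.
rewrite distrC => mu1 [B [_ _ BK]].
have [u [u1 umu]] := phase_exists (1 - lambda).
pose g : L := Lipschitz (radial_geometric_lipschitz u u1).
apply: (radial_not_lipschitz lambda u (B g) mu1 umu) => v.
by have /(congr1 (fun h : L => h v)) := BK g.
Qed.

End Spectrum.

Theorem theorem3p4 (R : realType) (T : rootedTree) :
  spectrum (@diff_op R T) = [set lambda : R[i] | `|lambda - 1| <= 1].
Proof.
apply/seteqP; split=> lambda /=; last exact: in_spectrum.
apply: contraPP => /negP.
rewrite -real_ltNge ?normr_real ?real1// => lambda_out.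
exact: not_in_spectrum.
Qed.
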